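(* Let $n\ge 3$ be an odd integer and let $Q$ be the symmetric star with $n$ arcs each of length $1/n$ (all $n$ arcs meeting at one center node). Then the value of the game $\Gamma'_1(Q)$ is $$\frac{n^2-1}{n(n^2+3)}.$$ The attacker's partition strategy is optimal. An optimal strategy for the defender is to place the booby trap at the center with probability $\frac{n^2-4n+3}{n^2+3}$, and, with the remaining probability $\frac{4n}{n^2+3}$, to place it uniformly at random (with respect to length) in the subset of $Q$ consisting of all points within distance $\frac{4}{n(n^2-1)}$ from the center.
   Context: The game $\Gamma'_1(Q)$ on a network $Q$ with length measure $\lambda$, $\lambda(Q)=1$: the defender chooses a point of $Q$ (the location of the single booby trap) and the attacker chooses a connected subset $S\subseteq Q$, without knowing each other's choice. The payoff to the attacker is $\lambda(S)$ if the booby trap is not in $S$, and $0$ otherwise; the attacker maximizes and the defender minimizes the expected payoff. Distances are shortest-path distances in $Q$. Mixed strategies are random choices of pure strategies (such that the payoff against each opposing pure strategy is measurable). The game has value $V$ if for every $\varepsilon>0$ the attacker has a mixed strategy with expected payoff at least $V-\varepsilon$ against every pure strategy of the defender, and the defender has a mixed strategy with expected payoff at most $V+\varepsilon$ against every pure strategy of the attacker. A mixed strategy of the defender (attacker) is optimal if it guarantees expected payoff at most (at least) $V$ against every opposing pure strategy. Partition strategy of the attacker: removing the center node (which is the centroid of the star) leaves $n$ components of lengths $a_1=\cdots=a_n=1/n$. For a nonempty $S\subseteq\{1,\dots,n\}$, put $D(S)=\sum_{j\notin S}\frac1{a_j}+\frac{1}{\sum_{j\in S}a_j}$ and consider the mixed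 strategy that takes the whole of component $i$ (without the center) with probability $\frac{1/a_i}{D(S)}$ for each $i\notin S$, and takes all components in $S$ together with the center with probability $\frac{1/\sum_{j\in S}a_j}{D(S)}$. This strategy guarantees expected payoff $W(S)=\frac{n-|S|}{D(S)}$. The partition strategy is the strategy of this form for a set $S$ maximizing $W(S)$. *)

(* Defs.v *)
From HB Require Import structures.
From mathcomp Require Import all_boot all_order all_algebra.
From mathcomp Require Import all_classical all_reals all_analysis.
From mathcomp Require Import measurable_realfun.
Set Implicit Arguments.
Unset Strict Implicit.
Unset Printing Implicit Defensive.
Import Order.TTheory GRing.Theory Num.Theory.
Import numFieldNormedType.Exports.
Local Open Scope classical_set_scope.
Local Open Scope ring_scope.

(* A network is given as a subset Q of an ambient topological space T, together
   with its length measure lambda; it carries the subspace topology. *)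
Section Network.
Context {R : realType} {T : topologicalType}.
Variables (Q : set T) (lambda : set T -> \bar R).

(* A simple path from x to y in Q; b = 0 gives the constant path when x = y. *)
Definition simple_path (x y : T) (g : R -> T) (b : R) : Prop :=
  [/\ 0 <= b, {within `[0, b], continuous g},
      {in `[0, b] &, injective g}, g @` `[0, b] `<=` Q & g 0 = x /\ g b = y].

(* The length of a simple path is the length measure of its trace. *)
Definition path_dist (x y : T) : \bar R :=
  ereal_inf [set l | exists g b,
    simple_path x y g b /\ l = lambda (g @` `[0, b])].

Definition attacker_pure (S : set T) : Prop := S `<=` Q /\ connected S.

Definition payoff (S : set T) (q : T) : \bar R :=
  if q \in S then 0%E else lambda S.

(* A mixed strategy is a random pure strategy, on an arbitrary probability
   space. *)
Record attacker_mixed : Type := AttackerMixed {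
  att_disp : measure_display;
  att_space : measurableType att_disp;
  att_prob : probability att_space R;
  att_choice :> att_space -> set T;
  att_pure : forall w, attacker_pure (att_choice w);
  att_measurable : forall q, Q q ->
    measurable_fun setT (fun w => payoff (att_choice w) q) }.

Record defender_mixed : Type := DefenderMixed {
  def_disp : measure_display;
  def_space : measurableType def_disp;
  def_prob : probability def_space R;
  def_choice :> def_space -> T;
  def_pure : forall w, Q (def_choice w);
  def_measurable : forall S, attacker_pure S ->
    measurable_fun setT (fun w => payoff S (def_choice w)) }.

Definition attacker_payoff (sigma : attacker_mixed) (q : T) : \bar R :=
  (\int[att_prob sigma]_w payoff (sigma w) q)%E.

Definition defender_payoff (tau : defender_mixed) (S : set T) : \bar R :=
  (\int[def_prob tau]_w payoff S (tau w))%E.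

Definition attacker_guarantees (sigma : attacker_mixed) (v : R) : Prop :=
  forall q, Q q -> (v%:E <= attacker_payoff sigma q)%E.

Definition defender_guarantees (tau : defender_mixed) (v : R) : Prop :=
  forall S, attacker_pure S -> (defender_payoff tau S <= v%:E)%E.

Definition game_value (V : R) : Prop :=
  forall e : R, 0 < e ->
    (exists sigma, attacker_guarantees sigma (V - e)) /\
    (exists tau, defender_guarantees tau (V + e)).

Definition attacker_optimal (sigma : attacker_mixed) : Prop :=
  exists V, game_value V /\ attacker_guarantees sigma V.

Definition defender_optimal (tau : defender_mixed) : Prop :=
  exists V, game_value V /\ defender_guarantees tau V.

End Network.

(* The symmetric star is realised in R^n, its i-th arc being the segment from
   the origin to e_i / n. *)
Section Star.
Variables (R : realType) (n : nat).

Definition arc_point (i : 'I_n) (t : R) : 'rV[R]_n := t *: delta_mx 0 i.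

Definition star : set 'rV[R]_n :=
  [set x | exists i t, 0 <= t <= n%:R^-1 /\ x = arc_point i t].

Definition star_center : 'rV[R]_n := 0.

(* Each arc is parametrised by arc length; the center, counted on every arc,
   is negligible. *)
Definition star_length (A : set 'rV[R]_n) : \bar R :=
  (\sum_(i < n)
     lebesgue_measure ([set t : R | 0 <= t <= n%:R^-1]%R `&` arc_point i @^-1` A))%E.

Definition star_ball (r : R) : set 'rV[R]_n :=
  [set x | star x /\ (path_dist star star_length star_center x <= r%:E)%E].

Definition star_component (i : 'I_n) : set 'rV[R]_n :=
  [set x | exists t : R, 0 < t <= n%:R^-1 /\ x = arc_point i t].

Definition star_attacker := attacker_mixed star star_length.
Definition star_defender := defender_mixed star star_length.

Definition component_length (_ : 'I_n) : R := n%:R^-1.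

Definition partition_D (a : 'I_n -> R) (S : {set 'I_n}) : R :=
  \sum_(j | j \notin S) (a j)^-1 + (\sum_(j in S) a j)^-1.

Definition partition_W (a : 'I_n -> R) (S : {set 'I_n}) : R :=
  (n%:R - #|S|%:R) / partition_D a S.

Definition partition_maximizer (a : 'I_n -> R) (S : {set 'I_n}) : Prop :=
  S != finset.set0 /\
  forall S' : {set 'I_n}, S' != finset.set0 ->
    partition_W a S' <= partition_W a S.

Definition takes_with_prob (sigma : star_attacker) (A : set 'rV[R]_n) (p : R) :
    Prop :=
  measurable [set w | sigma w = A] /\
  att_prob sigma [set w | sigma w = A] = p%:E.

Definition partition_strategy (a : 'I_n -> R) (S : {set 'I_n})
    (sigma : star_attacker) : Prop :=
  (forall i, i \notin S ->
     takes_with_prob sigma (star_component i) ((a i)^-1 / partition_D a S)) /\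
  takes_with_prob sigma
    ([set star_center] `|` \bigcup_(i in [set` S]) star_component i)
    ((\sum_(j in S) a j)^-1 / partition_D a S).

(* The law of tau: the center with probability p, and with probability q a
   uniform point (with respect to length) of the ball of radius r. *)
Definition center_or_uniform (p q r : R) (tau : star_defender) : Prop :=
  forall A : set 'rV[R]_n, <<s [set U : set 'rV[R]_n | open U] >> A ->
    measurable (tau @^-1` A) /\
    def_prob tau (tau @^-1` A) =
      (p * \1_A star_center +
       q * (fine (star_length (A `&` star_ball r)) /
            fine (star_length (star_ball r))))%:E.

End Star.

Arguments star R n : clear implicits.
Arguments star_center R n : clear implicits.
Arguments star_length R n : clear implicits.
Arguments star_attacker R n : clear implicits.
Arguments star_defender R n : clear implicits.
Arguments component_length R n : clear implicits.

(* Main.v *)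
(* Each arc meets a connected set in an interval, so the length of an attack S
   and its length inside the ball B of radius r around the center are sums of
   interval lengths, and the payoff against the defender's strategy is
   lambda(S) times the probability of missing S. If S avoids the center it lies
   on one arc, and the payoff is at most a quadratic function of lambda(S :&: B)
   whose maximum, at lambda(S :&: B) = r, is the value. If S contains the center and
   covers exactly j >= 1 of the radii of B, the best it can do is to take these
   j arcs whole and nothing else, which yields 4 j (n - j) / (n (n^2 + 3)); as n
   is odd, 4 j (n - j) <= n^2 - 1. For j = 0 the payoff stays below the value.
   On the attacker's side the blocks of the partition strategy are disjoint and
   block k is chosen with probability 1 / (D(S) lambda(k)), so every block
   missed by the trap contributes 1 / D(S), and all but one of the n - #|S| + 1
   blocks are missed. *)
From HB Require Import structures.
Require Import Defs.
From mathcomp Require Import all_boot all_order all_algebra.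
From mathcomp Require Import all_classical all_reals all_analysis.
From mathcomp Require Import measurable_realfun ring lra.
Import numFieldNormedType.Exports.
Import Order.TTheory GRing.Theory Num.Theory.
Local Open Scope classical_set_scope.
Local Open Scope ring_scope.

Set Implicit Arguments.
Unset Strict Implicit.
Unset Printing Implicit Defensive.

(** The set measured by the [i]-th summand of [star_length]; through it questions about attacks
    become questions about subsets of the real line. *)
Definition arc_trace (R : realType) (n : nat) (A : set 'rV[R]_n) (i : 'I_n) :
  set R := [set t : R | 0 <= t <= n%:R^-1]%R `&` arc_point i @^-1` A.

(** * Connected subsets of the star *)

Section Geometry.
Context {R : realType} {n : nat}.
Implicit Types (S : set 'rV[R]_n) (i j : 'I_n) (t r : R).

Lemma arc_pointE i t j : arc_point i t 0 j = if j == i then t else 0.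
Proof. by rewrite !mxE eqxx /=; case: eqP => _; rewrite ?mulr1 ?mulr0. Qed.

Lemma arc_point0 i : arc_point i (0 : R) = 0.
Proof. by rewrite /arc_point scale0r. Qed.

Lemma continuous_arc_point i : continuous (arc_point i : R -> 'rV[R]_n).
Proof. by move=> x; exact: scalel_continuous. Qed.

Lemma star_arc_point i t : 0 <= t <= n%:R^-1 -> star R n (arc_point i t).
Proof. by exists i, t. Qed.

Lemma star_center_mem (i : 'I_n) : star R n (star_center R n).
Proof. by exists i, 0; rewrite arc_point0 lexx invr_ge0 ler0n. Qed.

Lemma star_coord_gt0 (x : 'rV[R]_n) i : star R n x -> 0 < x 0 i ->
  x = arc_point i (x 0 i) /\ x 0 i <= n%:R^-1.
Proof.
move=> [j [t [/andP[t0 tn] ->]]]; rewrite arc_pointE.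
by case: eqP => [->|_]; rewrite ?ltxx.
Qed.

Lemma is_interval_coord S i : connected S -> is_interval [set x 0 i | x in S].
Proof.
move=> cS; apply/connected_intervalP.
apply: (@connected_continuous_connected _ _ S (fun x : 'rV[R]_n => x 0 i)) => //.
by apply: continuous_subspaceT => x; exact: coord_continuous.
Qed.

(** The [i]-th coordinates of points of [S] form an interval, and a point of the star with positive
    [i]-th coordinate is determined by it. *)
Lemma is_interval_arc_trace S i : S `<=` star R n -> connected S ->
  is_interval (arc_trace S i).
Proof.
move=> Sstar cS a b [/andP[a0 an] Sa] [/andP[b0 bn] Sb] t /andP[at_ tb].
(* The left end is set apart because it may be 0, a coordinate shared by all the other arcs. *)
have [<-|a_t] := eqVneq a t; first by split => //; apply/andP.
have t0 : 0 < t by rewrite (le_lt_trans a0)// lt_neqAle a_t.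
have [x Sx xt] : [set x 0 i | x in S] t.
  apply: (is_interval_coord cS (x := a) (y := b)); last by rewrite at_ tb.
  - by exists (arc_point i a) => //; rewrite arc_pointE eqxx.
  - by exists (arc_point i b) => //; rewrite arc_pointE eqxx.
have [] := star_coord_gt0 (Sstar _ Sx) (i := i); rewrite xt// => xE tn.
by split; [rewrite /= (ltW t0)|rewrite /preimage/= -xE].
Qed.

(** If [i] and [j] differed, a continuous function equal to [t] on arc [i] and to [- t] on all other
    arcs would vanish somewhere on [S]. *)
Lemma arc_trace_inj S i j : S `<=` star R n -> connected S ->
  ~ S (star_center R n) ->
  arc_trace S i !=set0 -> arc_trace S j !=set0 -> i = j.
Proof.
move=> Sstar cS S0 [a [/andP[a0 an] Sa]] [b [/andP[b0 bn] Sb]].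
apply: contra_notP S0 => /eqP ij.
(* This function vanishes on the star only at the center. *)
pose f (x : 'rV[R]_n) := x 0 i - \sum_(k | k != i) x 0 k.
have fE k t : f (arc_point k t) = if k == i then t else - t.
  rewrite /f arc_pointE [i == k]eq_sym; have [->|ki] := eqVneq k i.
    rewrite big1 ?subr0// => l li; by rewrite arc_pointE (negbTE li).
  rewrite sub0r (bigD1 k)//= big1 => [|l /andP[_ lk]].
    by rewrite arc_pointE eqxx addr0.
  by rewrite arc_pointE (negbTE lk).
have cc k : continuous (fun y : 'rV[R]_n => y 0 k) by exact: coord_continuous.
have cs : continuous (fun y : 'rV[R]_n => \sum_(k | k != i) y 0 k).
  by apply: continuous_big => // -[? ?]; exact: add_continuous.
have fc : continuous f by move=> x; exact: cvgB (cc i x) (cs x).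
have fS : is_interval [set f x | x in S].
  apply/connected_intervalP; apply: connected_continuous_connected => //.
  exact: continuous_subspaceT.
have [x Sx] : [set f x | x in S] 0.
  apply: (fS (- b) a); last by rewrite a0 oppr_le0 b0.
  - by exists (arc_point j b) => //; rewrite fE eq_sym (negbTE ij).
  - by exists (arc_point i a) => //; rewrite fE eqxx.
have [k [t [_ xE]]] := Sstar _ Sx; rewrite xE fE => tE.
suff t0 : t = 0 by move: Sx; rewrite xE t0 arc_point0.
by move: tE; case: ifP => // _ /eqP; rewrite oppr_eq0 => /eqP.
Qed.

Lemma measurable_arc_trace S i : S `<=` star R n -> connected S ->
  measurable (arc_trace S i : set (measurableTypeR R)).
Proof.
by move=> Sstar cS; apply: is_interval_measurable; exact: is_interval_arc_trace.
Qed.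

(** The arc itself is a path of length [t]. Conversely the trace of any path is connected and
    contains both ends, hence the whole segment between them. *)
Lemma path_dist_arc_point i t : 0 <= t <= n%:R^-1 ->
  path_dist (star R n) (star_length R n) (star_center R n) (arc_point i t)
  = t%:E.
Proof.
move=> /andP[t0 tn]; apply/eqP; rewrite eq_le; apply/andP; split.
  apply: ereal_inf_lbound; exists (arc_point i), t; split.
    split => //.
    - by apply: continuous_subspaceT; exact: continuous_arc_point.
    - move=> x y _ _ /(congr1 (fun z : 'rV_n => z 0 i)).
      by rewrite !arc_pointE eqxx.
    - move=> _ [s /= /[!in_itv]/= /andP[s0 st] <-].
      by apply: star_arc_point; rewrite s0 (le_trans st).
    - by rewrite arc_point0.
  rewrite /star_length (bigD1 i)//= big1 ?adde0 => [|j ji].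
    rewrite (_ : _ `&` _ = `[0, t]%classic).
      rewrite lebesgue_measure_itv /= lte_fin oppr0 adde0.
      by case: ltP => // t0'; congr EFin; apply/eqP; rewrite eq_le t0 t0'.
    apply/seteqP; split => s /=.
      move=> [_ [u /=]] + /(congr1 (fun z : 'rV_n => z 0 i)).
      by rewrite !arc_pointE eqxx => + <-.
    rewrite in_itv/= => /andP[s0 st]; split; first by rewrite s0 (le_trans st).
    by exists s => //=; rewrite in_itv/= s0.
  (* The segment meets another arc in the center only, a null set. *)
  apply/eqP; rewrite -measure_le0 -(lebesgue_measure_set1 (0 : R)).
  apply: le_outer_measure => s [_ [u _]] /(congr1 (fun z : 'rV_n => z 0 j)).
  by rewrite !arc_pointE eqxx (negbTE ji) => <-.
apply: le_ereal_inf_tmp => _ [g [b [[b0 cg _ gstar [g0 gb]] ->]]].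
set S := g @` _ in gstar *.
have cS : connected S.
  by apply: connected_continuous_connected => //; exact: segment_connected.
have S0 : S (star_center R n).
  by exists 0 => //=; rewrite in_itv/= lexx b0.
have St : S (arc_point i t).
  by exists b => //=; rewrite in_itv/= lexx b0.
rewrite /star_length (bigD1 i)//= -[leLHS]adde0; apply: leeD.
  apply: (@le_trans _ _ (lebesgue_measure `[0, t]%classic)).
    rewrite lebesgue_measure_itv /= lte_fin oppr0 adde0.
    by case: ltP => // t0'; rewrite lee_fin.
  apply: le_outer_measure => s /=; rewrite in_itv/= => st.
  apply: (is_interval_arc_trace (i := i) gstar cS (x := 0) (y := t)) => //.
    by split; rewrite /preimage/= ?arc_point0// lexx (le_trans t0 tn).
  by split => //; rewrite /= t0.
by apply: sume_ge0.
Qed.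

Lemma arc_trace_star_ball S i r :
  arc_trace (S `&` star_ball r) i = arc_trace S i `&` `[0, r]%classic.
Proof.
apply/seteqP; split => t /=.
  move=> [t01 [St [_]]]; rewrite path_dist_arc_point// lee_fin => tr.
  by split => //; rewrite in_itv/= tr; case/andP: t01 => ->.
move=> [[t01 St]]; rewrite in_itv/= => /andP[t0 tr]; split => //; split => //.
by split; [exact: star_arc_point|rewrite path_dist_arc_point].
Qed.

(** The sigma-algebra over which [center_or_uniform] quantifies. *)
Definition borel_rV : Type :=
  g_sigma_algebraType [set U : set 'rV[R]_n | open U].

Lemma measurable_coord i :
  measurable_fun setT (fun x : borel_rV => x 0 i : measurableTypeR R).
Proof.
apply: (measurability _ (RGenOpens.measurableE R)) => _ [_ [a [b ->]] <-].
rewrite setTI; apply: sub_sigma_algebra.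
have /continuousP : continuous (fun x : 'rV[R]_n => x 0 i).
  exact: coord_continuous.
by apply; exact: interval_open.
Qed.

Lemma measurable_arc_point i :
  measurable_fun setT (arc_point i : measurableTypeR R -> borel_rV).
Proof.
apply: (@measurability _ _ (measurableTypeR R) borel_rV setT (arc_point i)
  [set U : set 'rV[R]_n | open U] erefl).
move=> _ [U oU <-]; rewrite setTI; apply: open_measurable.
by have /continuousP := @continuous_arc_point i; apply.
Qed.

(** Such a set is a finite union over [i] of sets cut out by coordinates: the [i]-th one lies in the
    trace, the others are 0. *)
Lemma measurable_star_subset (A : set 'rV[R]_n) : A `<=` star R n ->
  (forall i, measurable (arc_trace A i : set (measurableTypeR R))) ->
  measurable (A : set borel_rV).
Proof.
move=> Astar mA.
have -> : A = \bigcup_(i in [set: 'I_n])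
    ((fun x : 'rV[R]_n => x 0 i) @^-1` arc_trace A i `&`
     \bigcap_(j in [set j | j != i]) ((fun x : 'rV[R]_n => x 0 j) @^-1` [set 0])).
  apply/seteqP; split => [x Ax|x [i _ [[_ xi] x0]]].
    have [i [t [tn xE]]] := Astar _ Ax.
    exists i => //; split; rewrite /preimage/= xE ?arc_pointE ?eqxx.
      by split => //; rewrite /preimage/= -xE.
    by move=> j /= /negbTE ji; rewrite arc_pointE ji.
  suff -> : x = arc_point i (x 0 i) by [].
  apply/rowP => j; rewrite arc_pointE; case: eqP => [->//|/eqP ji].
  exact: (x0 _ ji).
apply: fin_bigcup_measurable => // i _; apply: measurableI.
  by rewrite -[X in measurable X]setTI; exact: measurable_coord.
apply: fin_bigcap_measurable => [|j _]; first exact: finite_finset.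
by rewrite -[X in measurable X]setTI; exact: measurable_coord.
Qed.

(** Allows the law of the defender's strategy to be evaluated at every attack. *)
Lemma measurable_attacker_pure S : attacker_pure (star R n) S ->
  measurable (S : set borel_rV).
Proof.
move=> [Sstar cS]; apply: measurable_star_subset => // i.
exact: measurable_arc_trace.
Qed.

Lemma measurable_star : measurable (star R n : set borel_rV).
Proof.
apply: measurable_star_subset => // i.
rewrite (_ : arc_trace _ _ = `[0, n%:R^-1]%classic); first exact: measurable_itv.
apply/seteqP; split => t; rewrite /= in_itv/=; first by case.
by move=> tn; split => //; exact: star_arc_point.
Qed.

End Geometry.
Arguments borel_rV : clear implicits.

(** * Quadratic bounds *)

Section Numbers.
Context {R : realType}.
Implicit Types x : R.

(* For a defender mixing the center (probability [1 - q]) with the uniform law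
   on the ball of radius [r] (probability [q]), [k] is the probability per unit
   of length, i.e. [q / (n r)]. *)
Definition defender_radius x : R := 4 / (x * (x ^+ 2 - 1)).
Definition defender_density x : R := x * (x ^+ 2 - 1) / (x ^+ 2 + 3).
Definition star_value x : R := (x ^+ 2 - 1) / (x * (x ^+ 2 + 3)).

Lemma natr_odd_half (n : nat) : odd n -> n%:R = n./2%:R + n./2%:R + 1 :> R.
Proof.
by move=> n_odd; rewrite -natrD natr1 addnn -[in LHS](odd_double_half n) n_odd.
Qed.

(** With [n = 2 h + 1] the difference of the two sides is [4 (h - j) (h + 1 - j)], and no integer
    lies strictly between [h] and [h + 1]. *)
Lemma odd_quarter_square (n j : nat) : odd n ->
  4 * j%:R * (n%:R - j%:R) <= n%:R ^+ 2 - 1 :> R.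
Proof.
move=> n_odd; rewrite (natr_odd_half n_odd); set h := n./2.
have [jh|hj] := leqP j h.
  by have : j%:R <= h%:R :> R; [rewrite ler_nat|nra].
by have : h%:R + 1 <= j%:R :> R; [rewrite natr1 ler_nat|nra].
Qed.

Lemma defender_radius_gt0 x : 3 <= x -> 0 < defender_radius x.
Proof. by move=> x3; rewrite divr_gt0// mulr_gt0; nra. Qed.

Lemma defender_radius_le x : 3 <= x -> defender_radius x <= x^-1.
Proof.
move=> x3; have h : 4 / (x ^+ 2 - 1) <= 1 by rewrite ler_pdivrMr; nra.
by rewrite /defender_radius invfM mulrCA ler_piMr// invr_ge0; lra.
Qed.

(** Here [l] is the length of an attack on one arc and [m] its length inside the ball. At the
    largest [l] allowed by [m], the payoff falls short of the value by exactly the density times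
    [(r - m)^2], with [r] the radius. *)
Lemma arc_payoff_bound x l m : 3 <= x -> 0 <= m <= defender_radius x ->
  l - m <= x^-1 - defender_radius x ->
  l * (1 - defender_density x * m) <= star_value x.
Proof.
move=> x3 /andP[m0 mr] lm.
have x2 : 0 < x ^+ 2 - 1 by nra.
have x2' : 0 < x ^+ 2 + 3 by nra.
have x0 : 0 < x by lra.
have k0 : 0 <= defender_density x.
  by rewrite /defender_density divr_ge0 ?mulr_ge0// ltW.
have kr : defender_density x * defender_radius x = 4 / (x ^+ 2 + 3).
  by rewrite /defender_density /defender_radius; field; rewrite !gt_eqF.
have km : 0 <= 1 - defender_density x * m.
  rewrite subr_ge0 (le_trans (ler_wpM2l k0 mr))// kr ler_pdivrMr//.
  by nra.
apply: (@le_trans _ _ ((m + x^-1 - defender_radius x) *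
                       (1 - defender_density x * m))).
  by apply: ler_wpM2r => //; lra.
rewrite -subr_ge0.
suff -> : star_value x - (m + x^-1 - defender_radius x) *
    (1 - defender_density x * m) =
    defender_density x * (defender_radius x - m) ^+ 2.
  by rewrite mulr_ge0// sqr_ge0.
rewrite /star_value /defender_density /defender_radius.
by field; rewrite !gt_eqF.
Qed.

(** Here [j] counts the radii of the ball that are fully covered and [y] is the covered length on
    the remaining radii. The first factor bounds the length of the attack, the second is the
    probability of missing the trap. *)
Lemma center_payoff_bound_aux x j y : 3 <= x -> j <= x -> j = 0 \/ 1 <= j ->
  4 * j * (x - j) <= x ^+ 2 - 1 -> 0 <= y <= (x - j) * defender_radius x ->
  (j / x + y) *
    (4 * x / (x ^+ 2 + 3) - defender_density x * (j * defender_radius x + y))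
  <= star_value x.
Proof.
move=> x3 jx j01 jq /andP[y0 yr].
have x2 : 0 < x ^+ 2 - 1 by nra.
have x2' : 0 < x ^+ 2 + 3 by nra.
have x0 : 0 < x by lra.
have r0 := defender_radius_gt0 x3.
(* Measuring [y] in radii turns the product into a constant times [(j + c z) (x - j - z)], where [c]
   is [x] times the radius. *)
pose z := y / defender_radius x.
have z0 : 0 <= z by rewrite divr_ge0// ltW.
have zj : z <= x - j by rewrite ler_pdivrMr.
have -> : y = z * defender_radius x by rewrite divfK// gt_eqF.
pose c := 4 / (x ^+ 2 - 1).
have c0 : 0 < c by rewrite divr_gt0.
have cx : c * (x ^+ 2 - 1) = 4 by rewrite divfK// gt_eqF.
have -> : (j / x + z * defender_radius x) *
    (4 * x / (x ^+ 2 + 3) -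
     defender_density x * (j * defender_radius x + z * defender_radius x)) =
    4 / (x * (x ^+ 2 + 3)) * ((j + c * z) * (x - j - z)).
  rewrite /defender_density /defender_radius /c.
  by field; rewrite !gt_eqF.
suff main : (j + c * z) * (x - j - z) <= (x ^+ 2 - 1) / 4.
  apply: (@le_trans _ _ (4 / (x * (x ^+ 2 + 3)) * ((x ^+ 2 - 1) / 4))).
    by apply: ler_wpM2l => //; rewrite divr_ge0// mulr_ge0// ltW.
  rewrite [leLHS](_ : _ = star_value x)// /star_value.
  by field; rewrite !gt_eqF.
(* For [j = 0] the product is at most [c x^2 / 4 = 1 + c / 4 <= 9 / 8], while the bound is at least
   2. *)
case: j01 => [j0|j1].
  rewrite j0 in zj *.
  have x9 : 9 <= x ^+ 2 by nra.
  have c2 : c <= 2^-1 by rewrite ler_pdivrMr//; lra.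
  have : z * (x - z) <= x ^+ 2 / 4 by have := sqr_ge0 (x / 2 - z); lra.
  move=> /(ler_wpM2l (ltW c0)).
  have : c * (x ^+ 2 / 4) = (c * (x ^+ 2 - 1) + c) / 4 by field.
  rewrite cx => ->; lra.
(* The product equals [j (x - j) + z (c (x - j) - j) - c z^2], so once this holds a positive [z]
   brings no gain. *)
have cxj : c * (x - j) <= j.
  apply: (le_trans _ j1).
  have : c * (x - j) <= c * (x - 1) by apply: ler_wpM2l; [exact: ltW|lra].
  move=> /le_trans; apply.
  have : c * (x - 1) * (x + 1) = 4 by rewrite -cx; ring.
  by set w := c * (x - 1); nra.
have := mulr_ge0 (mulr_ge0 z0 z0) (ltW c0).
have := ler_wpM2l z0 cxj; lra.
Qed.

Lemma center_payoff_bound (n : nat) (l m : 'I_n -> R) : (3 <= n)%N -> odd n ->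
  (forall i, 0 <= m i <= defender_radius n%:R) ->
  (forall i, m i = l i \/ m i = defender_radius n%:R /\ l i <= n%:R^-1) ->
  (\sum_i l i) *
    (4 * n%:R / (n%:R ^+ 2 + 3) - defender_density n%:R * \sum_i m i)
  <= star_value n%:R.
Proof.
move=> n3 n_odd m_ge lm.
have x3 : 3 <= n%:R :> R by rewrite ler_nat.
set r := defender_radius n%:R in m_ge lm *.
set k := defender_density n%:R.
have kr : k * r * n%:R = 4 * n%:R / (n%:R ^+ 2 + 3).
  rewrite /k /r /defender_density /defender_radius.
  by field; apply/and3P; split; apply: lt0r_neq0; nra.
have k0 : 0 <= k.
  by rewrite /k /defender_density divr_ge0 ?mulr_ge0//; nra.
(* Arcs in [J] have length at most [1 / n]; on all other arcs the attack stays inside the ball, so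
   [l i = m i]. *)
pose J : {set 'I_n} := [set i | m i == r]%SET.
pose Y := \sum_(i | i \notin J) m i.
have mE : \sum_i m i = #|J|%:R * r + Y.
  rewrite (bigID (mem J))/=; congr +%R.
  rewrite (eq_bigr (fun=> r)) => [|i]; last by rewrite inE => /eqP.
  by rewrite sumr_const mulr_natl.
have lE : \sum_i l i <= #|J|%:R / n%:R + Y.
  rewrite (bigID (mem J))/=; apply: lerD.
    rewrite mulr_natl -sumr_const; apply: ler_sum => i.
    rewrite inE => /eqP mir; have [<-|[]//] := lm i.
    by rewrite mir defender_radius_le.
  apply: ler_sum => i; rewrite inE => /eqP mir.
  by have [->//|[]] := lm i.
have Jn : #|J|%:R <= n%:R :> R by rewrite ler_nat -[leqRHS]card_ord max_card.
have Y0 : 0 <= Y by apply: sumr_ge0 => i _; case/andP: (m_ge i).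
have Yr : Y <= (n%:R - #|J|%:R) * r.
  rewrite mulrBl lerBrDl -mE.
  apply: (@le_trans _ _ (\sum_(i < n) r)).
    by apply: ler_sum => i _; case/andP: (m_ge i).
  by rewrite sumr_const card_ord mulr_natl.
apply: (@le_trans _ _ ((#|J|%:R / n%:R + Y) *
   (4 * n%:R / (n%:R ^+ 2 + 3) - k * (#|J|%:R * r + Y)))).
  (* The second factor is nonnegative: it is [k] times the part of the total radius [n r] left
     uncovered. *)
  rewrite mE; apply: ler_wpM2r lE.
  rewrite -kr -mulrA -mulrBr mulr_ge0// subr_ge0; lra.
apply: center_payoff_bound_aux => //; last by rewrite Y0.
  by case: #|J| => [|j]; [left|right; rewrite ler1n].
exact: odd_quarter_square.
Qed.

End Numbers.

(** * The defender *)

Section Lengths.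
Context {R : realType} {n : nat}.
Implicit Types (A S : set 'rV[R]_n) (i : 'I_n) (r : R).

Definition arc_length A i : R := fine (lebesgue_measure (arc_trace A i)).

Lemma lebesgue_itvcc (a b : R) : a <= b ->
  lebesgue_measure (`[a, b]%classic : set R) = (b - a)%:E.
Proof.
move=> ab; rewrite lebesgue_measure_itv /= lte_fin.
by case: ltgtP ab => // -> _; rewrite subrr.
Qed.

Lemma lebesgue_measure_arc_trace A i :
  lebesgue_measure (arc_trace A i) = (arc_length A i)%:E.
Proof.
rewrite fineK// ge0_fin_numE//.
apply: (@le_lt_trans _ _ (lebesgue_measure (`[0, n%:R^-1]%classic : set R))).
  by apply: le_outer_measure => t [tn _]; rewrite /= in_itv.
by rewrite lebesgue_itvcc ?invr_ge0// ltry.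
Qed.

Lemma arc_length_ge0 A i : 0 <= arc_length A i.
Proof. by rewrite -lee_fin -lebesgue_measure_arc_trace. Qed.

Lemma arc_length_le A i : arc_length A i <= n%:R^-1.
Proof.
rewrite -lee_fin -lebesgue_measure_arc_trace -[n%:R^-1]subr0.
rewrite -lebesgue_itvcc ?invr_ge0//.
by apply: le_outer_measure => t [tn _]; rewrite /= in_itv.
Qed.

Lemma arc_length0 A i : arc_trace A i = set0 -> arc_length A i = 0.
Proof. by rewrite /arc_length => ->; rewrite measure0. Qed.

Lemma star_lengthE A : star_length R n A = (\sum_i arc_length A i)%:E.
Proof.
by rewrite -sumEFin; apply: eq_bigr => i _; exact: lebesgue_measure_arc_trace.
Qed.

Lemma arc_length_ball A i r : 0 <= r -> arc_length (A `&` star_ball r) i <= r.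
Proof.
move=> r0; rewrite -lee_fin -lebesgue_measure_arc_trace arc_trace_star_ball.
rewrite -[X in (_ <= X%:E)%E]subr0 -lebesgue_itvcc//.
by apply: le_outer_measure => t [].
Qed.

Lemma arc_length_star_ball i r : 0 <= r <= n%:R^-1 ->
  arc_length (star_ball r) i = r.
Proof.
move=> /andP[r0 rn]; rewrite -[star_ball r]setTI /arc_length arc_trace_star_ball.
rewrite (_ : _ `&` _ = `[0, r]%classic) ?lebesgue_itvcc ?subr0//.
apply/seteqP; split => t; first by case.
rewrite /= !in_itv/= => t0r; split => //; split => //=.
by case/andP: t0r => -> /le_trans ->.
Qed.

Lemma star_length_star_ball r : 0 <= r <= n%:R^-1 ->
  star_length R n (star_ball r) = (n%:R * r)%:E.
Proof.
move=> r01; rewrite star_lengthE (eq_bigr (fun=> r)) => [|i _]; last first.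
  exact: arc_length_star_ball.
by rewrite sumr_const card_ord mulr_natl.
Qed.

(** What lies outside the ball has parameters between [r] and [1 / n]. As [A] is arbitrary,
    subadditivity of the outer measure is used. *)
Lemma arc_length_outside_ball A i r : r <= n%:R^-1 ->
  arc_length A i - arc_length (A `&` star_ball r) i <= n%:R^-1 - r.
Proof.
move=> rn; rewrite lerBlDl -lee_fin EFinD -!lebesgue_measure_arc_trace.
rewrite arc_trace_star_ball -lebesgue_itvcc//.
apply: le_trans (outer_measureU2 _ _ _); apply: le_outer_measure => t At.
have [tr|rt] := leP t r; [left|right].
  by split => //=; rewrite in_itv/= tr; case: At => /andP[->].
by rewrite /= in_itv/= (ltW rt); case: At => /andP[_ ->].
Qed.

(** The trace is an interval containing 0, so it is either contained in [[0, r]] or contains it. *)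
Lemma arc_length_center S i r : attacker_pure (star R n) S ->
  S (star_center R n) -> 0 <= r <= n%:R^-1 ->
  arc_length (S `&` star_ball r) i = arc_length S i \/
  arc_length (S `&` star_ball r) i = r /\ arc_length S i <= n%:R^-1.
Proof.
move=> [Sstar cS] S0 /andP[r0 rn].
have [Sr|] := pselect (arc_trace S i `<=` `[0, r]%classic).
  by left; rewrite /arc_length arc_trace_star_ball setIidl.
move=> /existsNP[t] /not_implyP[St].
rewrite /= in_itv/= => /negP; rewrite negb_and -!ltNge => tr.
have {}tr : r < t by move: tr; case: St => /andP[t0 _] _; rewrite ltNge t0.
right; split; last exact: arc_length_le.
rewrite /arc_length arc_trace_star_ball setIidr ?lebesgue_itvcc ?subr0//.
move=> s /=; rewrite in_itv/= => /andP[s0 sr].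
apply: (is_interval_arc_trace (i := i) Sstar cS (x := 0) _ St).
  by split; rewrite /preimage/= ?arc_point0// lexx invr_ge0 ler0n.
by rewrite s0 (le_trans sr)// ltW.
Qed.

End Lengths.

(** * Payoff against the defender's strategy *)

Section Defender.
Context {R : realType} {n : nat}.
Implicit Types (S : set 'rV[R]_n) (tau : star_defender R n).

Lemma star_payoff_ge0 S (x : 'rV[R]_n) : (0 <= payoff (star_length R n) S x)%E.
Proof.
rewrite /payoff; case: ifP => // _; rewrite star_lengthE lee_fin.
by apply: sumr_ge0 => i _; exact: arc_length_ge0.
Qed.

Lemma payoff_indic S (x : 'rV[R]_n) :
  payoff (star_length R n) S x =
  ((\sum_i arc_length S i)%:E * (\1_(~` S) x)%:E)%E.
Proof.
rewrite /payoff star_lengthE indicE in_setC.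
by case: (x \in S) => /=; rewrite ?mule0 ?mule1.
Qed.

Lemma defender_payoffE tau S : measurable (tau @^-1` S) ->
  defender_payoff tau S =
  ((\sum_i arc_length S i)%:E * (1 - def_prob tau (tau @^-1` S)))%E.
Proof.
move=> mS; rewrite /defender_payoff.
have E w : payoff (star_length R n) S (tau w) =
    ((\sum_i arc_length S i)%:E * (\1_(tau @^-1` (~` S)) w)%:E)%E.
  exact: payoff_indic.
under eq_integral do rewrite E.
have mSC : measurable (tau @^-1` (~` S)).
  by rewrite preimage_setC; exact: measurableC.
rewrite ge0_integralZl_EFin//; last 2 first.
- by apply/measurable_EFinP; exact: measurable_indic.
- by apply: sumr_ge0 => i _; exact: arc_length_ge0.
by rewrite integral_indic// setIT preimage_setC; congr (_ * _)%E;
  exact: probability_setC.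
Qed.

Lemma defender_guarantees_star_value tau : (3 <= n)%N -> odd n ->
  center_or_uniform ((n%:R ^+ 2 - 4 * n%:R + 3) / (n%:R ^+ 2 + 3))
    (4 * n%:R / (n%:R ^+ 2 + 3)) (defender_radius n%:R) tau ->
  defender_guarantees tau (star_value n%:R).
Proof.
move=> n3 n_odd tauE S pureS; have [Sstar cS] := pureS.
have x3 : 3 <= n%:R :> R by rewrite ler_nat.
have [mS PS] := tauE S (measurable_attacker_pure pureS).
rewrite defender_payoffE// PS -EFinB -EFinM lee_fin.
have r0 : 0 <= defender_radius (n%:R : R) <= n%:R^-1.
  by rewrite defender_radius_le// ltW// defender_radius_gt0.
set r := defender_radius _ in r0 *.
rewrite star_length_star_ball// star_lengthE /=.
set M := \sum_i arc_length (S `&` _) i.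
have -> : 4 * n%:R / (n%:R ^+ 2 + 3) * (M / (n%:R * r)) =
    defender_density n%:R * M.
  rewrite /r /defender_density /defender_radius.
  by field; do !(apply/andP; split); apply: lt0r_neq0; nra.
have m_ge i : 0 <= arc_length (S `&` star_ball r) i <= r.
  by rewrite arc_length_ge0 arc_length_ball//; case/andP: r0.
rewrite indicE; have [S0|S0] := pselect (S (star_center R n)).
  rewrite mem_set// mulr1 opprD addrA.
  (* A trap at the center is always hit, so the attack can only survive in the uniform mode. *)
  have -> : 1 - (n%:R ^+ 2 - 4 * n%:R + 3) / (n%:R ^+ 2 + 3) =
      4 * n%:R / (n%:R ^+ 2 + 3) :> R.
    by field; apply: lt0r_neq0; nra.
  by apply: center_payoff_bound => // i; exact: arc_length_center.
rewrite memNset// mulr0 add0r.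
have [[i Si]|S_empty] := pselect (exists i, arc_trace S i !=set0).
  have zero A j : A `<=` S -> j != i -> arc_length A j = 0.
    move=> AS ji; apply: arc_length0; apply: contrapT => /eqP/set0P Aj.
    suff ij : i = j by rewrite ij eqxx in ji.
    apply: (arc_trace_inj Sstar cS S0 Si).
    by have [t [tn /AS]] := Aj; exists t.
  rewrite /M (bigD1 i)//= big1 ?addr0 => [|j]; last exact: zero.
  rewrite (bigD1 i)//= big1 ?addr0 => [|j]; last by apply: zero => x [].
  apply: arc_payoff_bound => //.
  by apply: arc_length_outside_ball; case/andP: r0.
(* All traces are empty, so the attack has length 0 and only the sign of the value matters. *)
rewrite big1 ?mul0r => [|i _].
  by rewrite divr_ge0// ?mulr_ge0//; nra.
apply: arc_length0; apply: contrapT => /eqP/set0P Si.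
by apply: S_empty; exists i.
Qed.

End Defender.

(** * Construction of the defender's strategy *)

Section DefenderLaw.
Context {R : realType} {n : nat} (p q r : R) (i0 : 'I_n).
Context (p_ge0 : 0 <= p) (q_ge0 : 0 <= q) (pq1 : p + q = 1).
Context (r_gt0 : 0 < r) (r_le : r <= n%:R^-1).

Definition arc_law (i : 'I_n) : set (borel_rV R n) -> \bar R :=
  pushforward (mrestr (@lebesgue_measure R) (measurable_itv `[0, r]))
    (arc_point i : measurableTypeR R -> borel_rV R n).

Let arc_law0 i : arc_law i set0 = 0%E.
Proof. by apply: measure0; exact: measurable_arc_point. Qed.

Let arc_law_ge0 i A : (0 <= arc_law i A)%E.
Proof. by apply: measure_ge0; exact: measurable_arc_point. Qed.

Let arc_law_sigma_additive i : semi_sigma_additive (arc_law i).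
Proof. by apply: measure_semi_sigma_additive; exact: measurable_arc_point. Qed.

HB.instance Definition _ i := isMeasure.Build _ _ _ (arc_law i)
  (arc_law0 i) (@arc_law_ge0 i) (@arc_law_sigma_additive i).

Let density_ge0 : 0 <= q / (n%:R * r).
Proof. by rewrite divr_ge0// mulr_ge0// ltW. Qed.

(** The arc laws add up to length on the ball, of total mass [n r]. The default [i0] only makes
    [arc_law] a sequence; [msum] stops before reaching it. *)
Definition defender_law : set (borel_rV R n) -> \bar R :=
  measure_add
    (mscale (NngNum p_ge0) (@dirac _ (borel_rV R n) (star_center R n) R))
    (mscale (NngNum density_ge0) (msum (fun k => arc_law (insubd i0 k)) n)).

HB.instance Definition _ := Measure.on defender_law.

Let r_itv : 0 <= r <= n%:R^-1.
Proof. by rewrite r_le ltW. Qed.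

Lemma defender_lawE A : defender_law A =
  (p * \1_A (star_center R n) +
   q * (fine (star_length R n (A `&` star_ball r)) /
        fine (star_length R n (star_ball r))))%:E.
Proof.
rewrite /defender_law measure_addE /mscale /= star_length_star_ball//.
rewrite EFinD EFinM; congr (_ + _)%E.
rewrite star_lengthE /= mulrA mulrAC EFinM -sumEFin.
congr (_ * _)%E; rewrite /msum; apply: eq_bigr => i _.
rewrite valKd -lebesgue_measure_arc_trace arc_trace_star_ball.
congr (lebesgue_measure _); apply/seteqP; split => t [].
  (* The bound [t <= 1 / n] in the trace follows from [t <= r]. *)
  move=> At tr; split => //; split => //=.
  by move: tr; rewrite /= in_itv/= => /andP[-> /le_trans ->].
by case.
Qed.

Let defender_lawT : defender_law setT = 1%E.
Proof.
rewrite defender_lawE setTI star_length_star_ball//= divff.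
  by rewrite indicE in_setT !mulr1 pq1.
by rewrite mulf_neq0 ?gt_eqF// ltr0n (leq_ltn_trans _ (ltn_ord i0)).
Qed.

HB.instance Definition _ := Measure_isProbability.Build _ _ _
  defender_law defender_lawT.

(* [defender_law] lives on all of R^n, so the points off the star, which have
   probability 0, are sent to the center. *)
Definition star_retract (x : borel_rV R n) : 'rV[R]_n :=
  if x \in star R n then x else star_center R n.

Lemma star_retract_mem x : star R n (star_retract x).
Proof.
by rewrite /star_retract; case: ifPn => [/set_mem//|_]; exact: star_center_mem i0.
Qed.

Lemma preimage_star_retract (A : set 'rV[R]_n) : star_retract @^-1` A =
  (A `&` star R n) `|` (if star_center R n \in A then ~` star R n else set0).
Proof.
apply/seteqP; split => x; rewrite /preimage/= /star_retract.
  case: ifPn => [/set_mem xs|/negP xs] Ax; first by left.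
  by right; rewrite mem_set// => /mem_set.
case=> [[Ax /mem_set ->]//|]; case: ifPn => // /set_mem A0 xs.
by rewrite memNset.
Qed.

Lemma measurable_star_retract (A : set 'rV[R]_n) :
  measurable (A : set (borel_rV R n)) ->
  measurable (star_retract @^-1` A : set (borel_rV R n)).
Proof.
move=> mA; rewrite preimage_star_retract.
have mstar := @measurable_star R n.
by apply: measurableU; [exact: measurableI|case: ifP => // _; exact: measurableC].
Qed.

Let measurable_payoff S : attacker_pure (star R n) S ->
  measurable_fun setT (fun w => payoff (star_length R n) S (star_retract w)).
Proof.
move=> pureS; rewrite (_ : (fun w => _) =
    (fun w => (\sum_i arc_length S i)%:E *
              (\1_(star_retract @^-1` (~` S)) w)%:E)%E); last first.
  by apply/funext => w; exact: payoff_indic.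
apply: measurable_funeM; apply/measurable_EFinP; apply: measurable_indic.
apply: measurable_star_retract; apply: measurableC.
exact: measurable_attacker_pure.
Qed.

Definition defender_strategy : star_defender R n :=
  @DefenderMixed R _ _ _ _ _ defender_law _ star_retract_mem measurable_payoff.

(** The retraction fixes the center and every point of the ball, so it does not change the law. *)
Lemma center_or_uniform_defender_strategy :
  center_or_uniform p q r defender_strategy.
Proof.
move=> A mA; split; first exact: measurable_star_retract.
rewrite [LHS]defender_lawE; congr EFin; congr (_ * _ + _ * (_ / _)).
  rewrite !indicE; congr (_%:R); congr nat_of_bool.
  apply/idP/idP => /set_mem A0; apply/mem_set; move: A0.
    by rewrite /preimage/= /star_retract mem_set//; exact: star_center_mem i0.
  by rewrite /preimage/= /star_retract mem_set//; exact: star_center_mem i0.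
congr (fine (star_length R n _)); apply/seteqP; split => x [Ax xb];
  by split => //; move: Ax; rewrite /preimage/= /star_retract mem_set//; case: xb.
Qed.

End DefenderLaw.

(** * The attacker *)

Section Attacker.
Context {R : realType} {n : nat}.
Implicit Types (sigma : star_attacker R n) (x : 'rV[R]_n).

Lemma attacker_payoff_ge sigma (I : finType) (P : pred I)
    (A : I -> set 'rV[R]_n) x : star R n x ->
  {in P &, injective A} ->
  (forall k, P k -> measurable [set w | sigma w = A k]) ->
  (\sum_(k | P k) payoff (star_length R n) (A k) x *
     att_prob sigma [set w | sigma w = A k]%classic <= attacker_payoff sigma x)%E.
Proof.
move=> Qx injA mA; rewrite big_mkcond/=.
pose f (k : I) w := if P k then
  (payoff (star_length R n) (A k) x * (\1_[set w | sigma w = A k] w)%:E)%E else 0%E.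
have f_ge0 k w : (0 <= f k w)%E.
  by rewrite /f; case: ifP => // _; rewrite mule_ge0 ?star_payoff_ge0 ?lee_fin.
have mf k : measurable_fun setT (f k).
  rewrite /f; case: (boolP (P k)) => Pk; last exact: measurable_cst.
  apply: measurable_funeM; apply/measurable_EFinP; apply: measurable_indic.
  exact: mA.
rewrite (eq_bigr (fun k => \int[att_prob sigma]_w f k w)%E) => [|k _].
  rewrite -ge0_integral_sum//; apply: ge0_le_integral => //.
  - by move=> w _; exact: sume_ge0.
  - exact: emeasurable_sum.
  - exact: att_measurable.
  - move=> w _; have [[k Pk wk]|no] := pselect (exists2 k, P k & sigma w = A k).
      rewrite (bigD1 k)//= big1 ?adde0 => [|l lk].
        by rewrite /f Pk indicE mem_set// mule1 wk.
      rewrite /f; case: ifP => // Pl; rewrite indicE memNset ?mule0//= => wl.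
      by move/eqP: lk; apply; apply: injA => //; rewrite -wl.
    rewrite big1 ?star_payoff_ge0// => k _.
    rewrite /f; case: ifP => // Pk; rewrite indicE memNset ?mule0//= => wk.
    by apply: no; exists k.
rewrite /f; case: (boolP (P k)) => Pk; last by rewrite integral0.
rewrite ge0_integralZl//; last exact: star_payoff_ge0.
- by rewrite integral_indic ?setIT//; exact: mA.
- by apply/measurable_EFinP; apply: measurable_indic; exact: mA.
Qed.

Implicit Types (S : {set 'I_n}) (i j : 'I_n) (k : option 'I_n).

(* The pure strategies of the partition strategy: [Some i] with [i \notin S] is
   the component [i], [None] the block of the center. *)
Definition block S k : set 'rV[R]_n :=
  if k is Some i then star_component i
  else [set star_center R n] `|` \bigcup_(i in [set` S]) star_component i.

Definition block_valid S : pred (option 'I_n) :=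
  fun k => if k is Some i then i \notin S else true.

(** The only block that can contain [x]: a point of the star has at most one positive coordinate, so
    the choice made by [pick] is forced there. *)
Definition block_index S x : option 'I_n :=
  [pick i | (i \notin S) && (0 < x 0 i)].

Lemma block_index_valid S x : block_valid S (block_index S x).
Proof. by rewrite /block_index; case: pickP => [i /andP[]|]. Qed.

Lemma block_indexE S k x : block_valid S k -> block S k x -> block_index S x = k.
Proof.
rewrite /block_index; case: k => [i|] /= => [iS [t [/andP[t0 tn] ->]]|_].
  case: pickP => [j /andP[_]|/(_ i)]; rewrite arc_pointE.
    by case: eqP => [->//|]; rewrite ltxx.
  by rewrite eqxx t0 iS.
move=> A; case: pickP => // j /andP[jS].
case: A => [->|[i iS [t [_ ->]]]]; first by rewrite mxE ltxx.
rewrite arc_pointE; case: eqP => [ji _|_]; last by rewrite ltxx.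
by rewrite ji (iS : i \in S) in jS.
Qed.

Lemma block_nonempty S k : (0 < n)%N -> block S k !=set0.
Proof.
move=> n0; case: k => [i|] /=; last by exists (star_center R n); left.
exists (arc_point i n%:R^-1), n%:R^-1; split => //.
by rewrite lexx invr_gt0 ltr0n n0.
Qed.

Lemma block_inj S : (0 < n)%N -> {in block_valid S &, injective (block S)}.
Proof.
move=> n0 k l vk vl kl; have [x xk] := block_nonempty S k n0.
by rewrite -(block_indexE vk xk); apply: block_indexE => //; rewrite -kl.
Qed.

Lemma star_component_star i : star_component i `<=` star R n.
Proof.
by move=> _ [t [/andP[t0 tn] ->]]; apply: star_arc_point; rewrite tn ltW.
Qed.

Lemma block_pure S k : S != finset.set0 -> attacker_pure (star R n) (block S k).
Proof.
move=> /set0Pn[s sS]; split.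
  case: k => [i|] /=; first exact: star_component_star.
  move=> x [->|[i _]]; first exact: star_center_mem s.
  exact: star_component_star.
case: k => [i|] /=.
  rewrite (_ : star_component i = arc_point i @` `]0, n%:R^-1]%classic).
    apply: connected_continuous_connected.
      exact/connected_intervalP/interval_is_interval.
    by apply: continuous_subspaceT; exact: continuous_arc_point.
  apply/seteqP; split => x.
    by move=> [t [tn ->]]; exists t => //=; rewrite in_itv.
  by move=> [t /=]; rewrite in_itv/= => tn <-; exists t.
(* Adding the center to each component gives closed segments with a common point; [S] being
   nonempty, their union contains the center. *)
rewrite (_ : _ `|` _ =
    \bigcup_(i in [set` S]) (arc_point i @` `[0, n%:R^-1]%classic)).
  apply: bigcup_connected.
    exists (star_center R n) => i _; exists 0; last exact: arc_point0.
    by rewrite /= in_itv/= lexx invr_ge0 ler0n.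
  move=> i _; apply: connected_continuous_connected.
    exact: segment_connected.
  by apply: continuous_subspaceT; exact: continuous_arc_point.
apply/seteqP; split => x.
  move=> [->|[i iS [t [/andP[t0 tn] ->]]]].
    exists s => //; exists 0; last exact: arc_point0.
    by rewrite /= in_itv/= lexx invr_ge0 ler0n.
  by exists i => //; exists t => //=; rewrite in_itv/= tn ltW.
move=> [i iS [t /=]]; rewrite in_itv/= => /andP[t0 tn] <-.
move: t0; rewrite le_eqVlt => /predU1P[<-|t0]; first by left; exact: arc_point0.
by right; exists i => //; exists t; rewrite t0.
Qed.

(** Up to the parameter 0, a null set, each trace is the full arc or empty. *)
Lemma arc_length_block S k j : arc_length (block S k) j =
  if (if k is Some i then j == i else j \in S) then n%:R^-1 else 0.
Proof.
have n0 : 0 <= n%:R^-1 :> R by rewrite invr_ge0.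
case: ifP => [jk|/negP jk].
  apply/eqP; rewrite eq_le arc_length_le /= -lee_fin.
  rewrite -lebesgue_measure_arc_trace.
  apply: (@le_trans _ _ (lebesgue_measure (`]0, n%:R^-1]%classic : set R))).
    rewrite lebesgue_measure_itv /= lte_fin oppr0 adde0.
    by case: ltP => // n0'; rewrite lee_fin.
  apply: le_outer_measure => t; rewrite /= in_itv/= => /andP[t0 tn].
  split; first by rewrite /= tn ltW.
  rewrite /preimage/=; case: k jk => [i /eqP ->|jS] /=.
    by exists t; rewrite t0.
  by right; exists j => //; exists t; rewrite t0.
apply/eqP; rewrite eq_le arc_length_ge0 andbT -lee_fin.
rewrite -lebesgue_measure_arc_trace.
apply: (@le_trans _ _ (lebesgue_measure [set (0 : R)])); last first.
  by rewrite lebesgue_measure_set1.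
apply: le_outer_measure => t [/andP[t0 _]]; rewrite /preimage/=.
move: t0; rewrite le_eqVlt => /predU1P[->//|t0] tk; exfalso; apply: jk.
have eq_arc i u : 0 < u -> arc_point j t = arc_point i u -> j = i.
  move=> u0 /(congr1 (fun y : 'rV_n => y 0 i)); rewrite !arc_pointE eqxx.
  by case: eqP => // _ u0'; rewrite -u0' ltxx in u0.
case: k tk => [i|] /= => [[u [/andP[u0 _] /(eq_arc _ _ u0) ->]]//|[]].
  move=> /(congr1 (fun y : 'rV_n => y 0 j)); rewrite arc_pointE eqxx mxE => t0'.
  by rewrite t0' ltxx in t0.
by move=> [i iS [u [/andP[u0 _] /(eq_arc _ _ u0) ->]]].
Qed.

Let a := component_length R n.

Definition block_prob S k : R :=
  (if k is Some i then (a i)^-1 else (\sum_(j in S) a j)^-1) / partition_D a S.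

(** [D(S)] is the sum of the inverse lengths of all blocks, so the block probabilities add up to
    1. *)
Lemma partition_DE S : partition_D a S = \sum_(k | block_valid S k)
  (if k is Some i then (a i)^-1 else (\sum_(j in S) a j)^-1).
Proof.
rewrite (bigD1 None)//= addrC; congr (_ + _).
rewrite (reindex_omap Some id) => [|[]//]; apply: eq_bigl => i.
by rewrite andbT eqxx andbT.
Qed.

Lemma sum_component_length S : \sum_(j in S) a j = #|S|%:R / n%:R.
Proof. by rewrite sumr_const mulr_natl. Qed.

Lemma partition_D_gt0 S : S != finset.set0 -> 0 < partition_D a S.
Proof.
move=> S0; apply: ltr_wpDl.
  by apply: sumr_ge0 => i _; rewrite !invr_ge0.
rewrite invr_gt0 sum_component_length divr_gt0// ltr0n.
  by rewrite card_gt0.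
by have /set0Pn[[i ni] _] := S0; exact: leq_ltn_trans ni.
Qed.

Lemma block_payoff S k x : S != finset.set0 -> block_valid S k ->
  (payoff (star_length R n) (block S k) x * (block_prob S k)%:E)%E =
  ((x \notin block S k)%:R / partition_D a S)%:E.
Proof.
move=> S0 vk; have /set0Pn[i0 i0S] := S0.
have n0 : (0 < n)%N by exact: leq_ltn_trans (ltn_ord i0).
have n0' : n%:R != 0 :> R by rewrite pnatr_eq0 -lt0n.
rewrite /payoff; case: (x \in _) => /=; first by rewrite mul0e mul0r.
rewrite star_lengthE -EFinM /block_prob mulrA; congr (_ / _)%:E.
under eq_bigr do rewrite arc_length_block.
rewrite -big_mkcond /=; case: k vk => [i _|_] /=.
  by rewrite big_pred1_eq divff// invr_eq0.
rewrite divff// sum_component_length mulf_neq0 ?invr_eq0//.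
by rewrite pnatr_eq0 cards_eq0.
Qed.

Lemma attacker_guarantees_partition_W S sigma : S != finset.set0 ->
  partition_strategy a S sigma -> attacker_guarantees sigma (partition_W a S).
Proof.
move=> S0 [comp center] x Qx; have /set0Pn[i0 i0S] := S0.
have n0 : (0 < n)%N by exact: leq_ltn_trans (ltn_ord i0).
have takes k : block_valid S k ->
    takes_with_prob sigma (block S k) (block_prob S k).
  by case: k => [i|_]; [exact: comp|exact: center].
apply: (le_trans _ (attacker_payoff_ge (P := block_valid S) Qx
  (@block_inj S n0) _)); last first.
  by move=> k /takes[].
rewrite (eq_bigr (fun k => ((x \notin block S k)%:R / partition_D a S)%:E));
  last first.
  by move=> k vk; have [_ ->] := takes k vk; exact: block_payoff.
rewrite sumEFin lee_fin /partition_W -mulr_suml ler_wpM2r//.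
  by rewrite invr_ge0 ltW// partition_D_gt0.
have -> : n%:R - #|S|%:R =
    \sum_(k | block_valid S k && (k != block_index S x)) 1 :> R.
  (* Restoring the excluded block leaves a count of all blocks: the [n - #|S|] single components and
     the block of the center. *)
  apply: (addrI 1); rewrite -[in RHS](bigD1 _ (block_index_valid S x)).
  rewrite (bigD1 None)//=; congr (_ + _).
  rewrite (reindex_omap Some id) => [|[]//].
  rewrite (eq_bigl (mem (~: S)%SET)) => [|i]; last by rewrite !inE eqxx !andbT.
  rewrite sumr_const cardsCs finset.setCK card_ord natrB//.
  by rewrite -[leqRHS]card_ord max_card.
rewrite big_mkcondr /=; apply: ler_sum => k vk.
case: eqP => //= ki; case: (boolP (x \in _)) => //.
move=> /set_mem /(block_indexE vk) ik.
by rewrite ik in ki.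
Qed.

(** For [#|S| = s] one has [W(S) = s (n - s) / (n (s (n - s) + 1))], and [s (n - s) = (n^2 - 1) / 4]
    when [s = (n - 1) / 2]. *)
Lemma partition_W_star_value S : (3 <= n)%N -> odd n ->
  #|S| = n./2 -> partition_W a S = star_value n%:R.
Proof.
move=> n3 n_odd Sn; rewrite /partition_W /partition_D sum_component_length.
rewrite (eq_bigl (mem (~: S)%SET)) => [|i]; last by rewrite !inE.
rewrite (eq_bigr (fun=> n%:R)) => [|i _]; last exact: invrK.
have cS : #|(~: S)%SET| = (n - #|S|)%N by rewrite cardsCs finset.setCK card_ord.
rewrite sumr_const cS -[n%:R *+ _]mulr_natl Sn.
rewrite natrB; last by rewrite -divn2 leq_div.
rewrite (natr_odd_half n_odd).
have : 1 <= n./2%:R :> R by rewrite ler1n half_gt0 ltnW.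
move: (n./2%:R : R) => h h1.
by rewrite /star_value; field; do !(apply/andP; split); apply: lt0r_neq0; nra.
Qed.

End Attacker.

(** * Construction of the partition strategy *)

Section AttackerLaw.
Context {R : realType} {n : nat} (S : {set 'I_n}) (S0 : S != finset.set0).

Let cardS_neq0 : #|S|%:R != 0 :> R.
Proof. by rewrite pnatr_eq0 cards_eq0. Qed.

(* The block of the center is drawn by drawing one of its components. *)
Definition component_block (i : 'I_n) : option 'I_n :=
  if i \in S then None else Some i.

Definition component_prob (i : 'I_n) : R :=
  if i \in S then block_prob S None / #|S|%:R else block_prob S (Some i).

Lemma component_block_valid i : block_valid S (component_block i).
Proof. by rewrite /component_block; case: ifPn. Qed.

Lemma component_prob_ge0 i : 0 <= component_prob i.
Proof.
have D0 := ltW (@partition_D_gt0 R n S S0).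
rewrite /component_prob /block_prob sum_component_length.
by case: ifP => _; rewrite !divr_ge0// !invr_ge0// divr_ge0.
Qed.

Lemma sum_component_prob k : block_valid S k ->
  \sum_i component_prob i * (component_block i == k)%:R = block_prob S k.
Proof.
rewrite /component_prob /component_block; case: k => [j /= jS|_].
  rewrite (bigD1 j)//= big1 ?addr0 => [|i ij].
    by rewrite (negbTE jS) eqxx mulr1.
  by case: ifP => _ /=; rewrite ?mulr0// (inj_eq Some_inj) (negbTE ij) mulr0.
rewrite (bigID (mem S))/= [X in _ + X]big1 ?addr0 => [|i /negbTE ->]; last first.
  by rewrite mulr0.
rewrite (eq_bigr (fun=> block_prob S None / #|S|%:R)) => [|i ->]; last first.
  by rewrite mulr1.
by rewrite sumr_const -[LHS]mulr_natr divfK.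
Qed.

Lemma sum_component_prob1 : \sum_i component_prob i = 1.
Proof.
have -> : \sum_i component_prob i = \sum_(k | block_valid S k) block_prob S k.
  under [RHS]eq_bigr => k vk do rewrite -sum_component_prob//.
  (* Each component is assigned to exactly one valid block. *)
  rewrite exchange_big/=; apply: eq_bigr => i _.
  rewrite (bigD1 (component_block i)) ?component_block_valid//= eqxx mulr1.
  by rewrite big1 ?addr0// => k /andP[_ ki]; rewrite eq_sym (negbTE ki) mulr0.
rewrite -mulr_suml -partition_DE divff//.
by rewrite gt_eqF// partition_D_gt0.
Qed.

(** The sample space is [nat], where every set is measurable; indices from [n] on get weight 0. *)
Definition nat_prob (l : nat) : R := oapp component_prob 0 (insub l).

Let nat_prob_ge0 l : 0 <= nat_prob l.
Proof. by rewrite /nat_prob; case: insub => // i; exact: component_prob_ge0. Qed.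

Definition attacker_law : set nat -> \bar R :=
  msum (fun l => mscale (NngNum (nat_prob_ge0 l)) (@dirac _ nat l R)) n.

HB.instance Definition _ := Measure.on attacker_law.

Lemma attacker_lawE (B : set nat) :
  attacker_law B = (\sum_(i < n) component_prob i * \1_B (val i))%:E.
Proof.
rewrite /attacker_law /msum -sumEFin; apply: eq_bigr => i _.
have probE : nat_prob i = component_prob i by rewrite /nat_prob valK.
by rewrite -probE.
Qed.

Let attacker_lawT : attacker_law setT = 1%E.
Proof.
rewrite attacker_lawE -sum_component_prob1; congr EFin; apply: eq_bigr => i _.
by rewrite indicE in_setT mulr1.
Qed.

HB.instance Definition _ := Measure_isProbability.Build _ _ _
  attacker_law attacker_lawT.

(** Indices from [n] on fall back to the block of the center, an event of probability 0. *)
Definition nat_block (l : nat) : option 'I_n := obind component_block (insub l).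

Let nat_block_pure l : attacker_pure (star R n) (block S (nat_block l)).
Proof. exact: block_pure. Qed.

Let measurable_block_payoff (x : 'rV[R]_n) : star R n x ->
  measurable_fun setT (fun l => payoff (star_length R n) (block S (nat_block l)) x).
Proof. by []. Qed.

Definition attacker_strategy : star_attacker R n :=
  @AttackerMixed R _ _ _ _ _ attacker_law _ nat_block_pure measurable_block_payoff.

Lemma partition_strategy_attacker_strategy :
  partition_strategy (component_length R n) S attacker_strategy.
Proof.
have /set0Pn[i0 _] := S0.
have n0 : (0 < n)%N by exact: leq_ltn_trans (ltn_ord i0).
suff takes k : block_valid S k ->
    takes_with_prob attacker_strategy (block S k) (block_prob S k).
  by split => [i iS|]; [exact: (takes (Some i))|exact: (takes None)].
move=> vk; split; first by [].
rewrite [LHS]attacker_lawE -sum_component_prob//; congr EFin.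
apply: eq_bigr => i _; congr (_ * _); rewrite indicE; congr (_%:R).
(* Distinct valid blocks are distinct sets, so the event that a given set is taken fixes the
   block. *)
congr nat_of_bool; apply/idP/eqP.
  move=> /set_mem /= /(block_inj n0).
  by rewrite /nat_block valK /=; apply => //; exact: component_block_valid.
by move=> <-; apply/mem_set; rewrite /= /nat_block valK.
Qed.

End AttackerLaw.

Theorem theorem14 (R : realType) (n : nat) (n_ge3 : (3 <= n)%N) (n_odd : odd n) :
  [/\ game_value (star R n) (star_length R n)
        ((n%:R ^+ 2 - 1) / (n%:R * (n%:R ^+ 2 + 3))),
      forall S : {set 'I_n},
        partition_maximizer (component_length R n) S ->
        (exists sigma : star_attacker R n,
           partition_strategy (component_length R n) S sigma) /\
        (forall sigma : star_attacker R n,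
           partition_strategy (component_length R n) S sigma ->
           attacker_optimal sigma) &
      let p := (n%:R ^+ 2 - 4 * n%:R + 3) / (n%:R ^+ 2 + 3) in
      let q := 4 * n%:R / (n%:R ^+ 2 + 3) in
      let r := 4 / (n%:R * (n%:R ^+ 2 - 1)) in
      (exists tau : star_defender R n, center_or_uniform p q r tau) /\
      (forall tau : star_defender R n,
         center_or_uniform p q r tau -> defender_optimal tau)].
Proof.
have x3 : 3 <= n%:R :> R by rewrite ler_nat.
have i0 : 'I_n by case: n n_ge3 {n_odd x3} => // m _; exact: ord0.
pose p : R := (n%:R ^+ 2 - 4 * n%:R + 3) / (n%:R ^+ 2 + 3).
pose q : R := 4 * n%:R / (n%:R ^+ 2 + 3).
have p_ge0 : 0 <= p by rewrite divr_ge0; nra.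
have q_ge0 : 0 <= q by rewrite divr_ge0; nra.
have pq1 : p + q = 1 by rewrite /p /q; field; apply: lt0r_neq0; nra.
have defender_ex : exists tau : star_defender R n,
    center_or_uniform p q (defender_radius n%:R) tau.
  exists (defender_strategy i0 p_ge0 q_ge0 pq1 (defender_radius_gt0 x3)
    (defender_radius_le x3)).
  exact: center_or_uniform_defender_strategy.
(* A set of [(n - 1) / 2] components whose guarantee matches the defender's bound. *)
have [S1 S1n0 WS1] : exists2 S : {set 'I_n}, S != finset.set0 &
    partition_W (component_length R n) S = star_value n%:R.
  have [S SE] : exists S : {set 'I_n}, #|S| = n./2.
    have : (n./2 <= #|[set: 'I_n]%SET|)%N.
      by rewrite cardsT card_ord -divn2 leq_div.
    move=> /card_geqP[s [us ss _]]; exists [set i in s]%SET.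
    by rewrite cardsE (card_uniqP us).
  exists S; last exact: partition_W_star_value.
  by rewrite -card_gt0 SE half_gt0 ltnW.
have value : game_value (star R n) (star_length R n) (star_value n%:R).
  move=> e e0; split.
    exists (attacker_strategy S1n0) => x Qx.
    apply: le_trans (attacker_guarantees_partition_W S1n0
      (partition_strategy_attacker_strategy S1n0) Qx).
    by rewrite lee_fin WS1 gerBl ltW.
  have [tau tauE] := defender_ex; exists tau => S pureS.
  apply: le_trans (defender_guarantees_star_value n_ge3 n_odd tauE pureS) _.
  by rewrite lee_fin lerDl ltW.
split => //.
  move=> S [S0 maxS]; split.
    by exists (attacker_strategy S0); exact: partition_strategy_attacker_strategy.
  move=> sigma sigmaS; exists (star_value n%:R); split => // x Qx.
  (* A maximizer guarantees at least as much as [S1], hence the value; its size is never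
     computed. *)
  apply: le_trans (attacker_guarantees_partition_W S0 sigmaS Qx).
  by rewrite lee_fin -WS1 maxS.
split => // tau tauE; exists (star_value n%:R); split => //.
exact: defender_guarantees_star_value.
Qed.
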